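(* Identify $(\mathbb{R}^4)^{\otimes2}$ with real $4\times4$ matrices, so that $\mathcal{S}_2=\{(P,Q)\in M_4(\mathbb{R})^2: P,Q\text{ entrywise nonnegative},\ KPK=Q\}$. Then $\mathcal{S}_2$ has exactly $252$ extremal rays and is the conic hull of the following three families, each of whose members generates an extremal ray: (i) 36 ''boxes'': $\big((|i\rangle+|j\rangle)(\langle k|+\langle l|),\ (|i'\rangle+|j'\rangle)(\langle k'|+\langle l'|)\big)$ for $2$-element subsets $\{i,j\},\{k,l\}\subset\{1,2,3,4\}$, where $\{i',j'\}$ and $\{k',l'\}$ are their complements in $\{1,2,3,4\}$; (ii) 24 ''diagonals'': $(U_\sigma,U_\sigma)$ for permutation matrices $U_\sigma$, $\sigma\in S_4$; (iii) 192 ''crosses'': the distinct pairs of the form $(U_{\sigma_1}P_3U_{\sigma_2},\ U_{\sigma_1}P_3^TU_{\sigma_2})$ or $(U_{\sigma_1}P_3^TU_{\sigma_2},\ U_{\sigma_1}P_3U_{\sigma_2})$, $\sigma_1,\sigma_2\in S_4$, where $P_3=\begin{pmatrix}1&0&0&0\\0&1&0&0\\0&0&1&0\\1&1&1&0\end{pmatrix}$.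
   Context: $K=\frac12\begin{pmatrix}-1&1&1&1\\1&-1&1&1\\1&1&-1&1\\1&1&1&-1\end{pmatrix}$. $\mathcal{S}_2$ is the cone of Pauli PPT spectra for $N=2$: pairs of entrywise nonnegative vectors $|p\rangle,|q\rangle\in(\mathbb{R}^4)^{\otimes2}$ with $K^{\otimes2}|p\rangle=|q\rangle$; under the identification $|i\rangle\otimes|j\rangle\leftrightarrow|i\rangle\langle j|$ the condition becomes $KPK^T=KPK=Q$. $|1\rangle,\dots,|4\rangle$ is the standard basis of $\mathbb{R}^4$. *)

(* Defs.v *)
From HB Require Import structures.
From mathcomp Require Import all_boot all_order fingroup perm all_algebra.
Set Implicit Arguments. Unset Strict Implicit. Unset Printing Implicit Defensive.
Import Order.TTheory GRing.Theory Num.Theory.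
Local Open Scope ring_scope.

(* A point of (R^4)^{(x)2} x (R^4)^{(x)2}, identified with a pair of 4x4 matrices. *)
Definition mpair (R : realFieldType) := ('M[R]_4 * 'M[R]_4)%type.

Definition Kmx (R : realFieldType) : 'M[R]_4 :=
  \matrix_(i < 4, j < 4) (if i == j then - (1 / 2) else 1 / 2).

Definition entrywise_nonneg (R : realFieldType) (A : 'M[R]_4) : Prop :=
  forall i j, 0 <= A i j.

(* The cone S_2 of Pauli PPT spectra for N = 2. *)
Definition S2 (R : realFieldType) (x : mpair R) : Prop :=
  entrywise_nonneg x.1 /\ entrywise_nonneg x.2 /\
  Kmx R *m x.1 *m Kmx R = x.2.

Definition pscale (R : realFieldType) (t : R) (x : mpair R) : mpair R :=
  (t *: x.1, t *: x.2).
Definition padd (R : realFieldType) (x y : mpair R) : mpair R :=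
  (x.1 + y.1, x.2 + y.2).

Definition extremal (R : realFieldType) (C : mpair R -> Prop) (x : mpair R) : Prop :=
  C x /\ x <> (0, 0) /\
  forall y z, C y -> C z -> x = padd y z -> exists t : R, 0 <= t /\ y = pscale t x.

(* Indicator matrix |A><B| of (sum_{i in A} |i>)(sum_{k in B} <k|) *)
Definition indmx (R : realFieldType) (A B : {set 'I_4}) : 'M[R]_4 :=
  \matrix_(i < 4, j < 4) ((i \in A) && (j \in B))%:R.

Definition two_subsets : seq {set 'I_4} := [seq A : {set 'I_4} <- enum [set: {set 'I_4}] | #|A| == 2%N].

Definition boxes (R : realFieldType) : seq (mpair R) :=
  [seq (indmx R A B, indmx R (~: A) (~: B)) | A <- two_subsets, B <- two_subsets].

Definition diagonals (R : realFieldType) : seq (mpair R) :=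
  [seq (perm_mx s, perm_mx s) | s <- enum [set: 'S_4]].

Definition P3 (R : realFieldType) : 'M[R]_4 :=
  \matrix_(i < 4, j < 4) (if val i == 3%N then val j != 3%N else i == j)%:R.

Definition crosses (R : realFieldType) : seq (mpair R) :=
  [seq (perm_mx s1 *m P3 R *m perm_mx s2, perm_mx s1 *m (P3 R)^T *m perm_mx s2)
     | s1 <- enum [set: 'S_4], s2 <- enum [set: 'S_4]]
  ++
  [seq (perm_mx s1 *m (P3 R)^T *m perm_mx s2, perm_mx s1 *m P3 R *m perm_mx s2)
     | s1 <- enum [set: 'S_4], s2 <- enum [set: 'S_4]].

Definition generators (R : realFieldType) : seq (mpair R) :=
  undup (boxes R ++ diagonals R ++ crosses R).

(* Main.v *)
Require Import Defs.
From HB Require Import structures.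
From mathcomp Require Import all_boot all_order fingroup perm all_algebra.
From mathcomp Require Import zify ring.
Import Order.TTheory GRing.Theory Num.Theory.
Set Implicit Arguments. Unset Strict Implicit. Unset Printing Implicit Defensive.

(** Every generator is a pair of 0/1 matrices, hence is determined by its support among the 32
    entries of [(P, Q)]. Everything follows from two facts on these 252 supports: they form an
    antichain, and the support of every nonzero point [x] of [S2] contains one of them. By the
    second fact a positive multiple of a generator can be subtracted from [x] so that the result
    stays in [S2] and has a smaller support, whence a conic decomposition by induction; by the first
    one, a generator is the only generator occurring in the decompositions of the points below it.

    For the second fact, regard "entry [c] vanishes" as 32 propositional variables. A point of [S2]
    satisfies identities [\sum_(c in A) x_c = \sum_(c in B) x_c], so that [x] cannot vanish on [B]
    and be nonzero somewhere on [A]. With three families of such identities, the assumption that no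
    generator is supported in [supp x] is propositionally contradictory; a decision tree with about
    150000 nodes witnesses it. *)

(* Entry [(i, j)] of [P] has index [4 i + j], entry [(i, j)] of [Q] has index [16 + 4 i + j]. *)
Definition pq_mask (p q : rel nat) : bitseq :=
  mkseq (fun c => (if c < 16 then p else q) (c %/ 4 %% 4) (c %% 4)) 32.

Definition box_mask (a b : bitseq) : bitseq :=
  pq_mask (fun i j => nth false a i && nth false b j)
       (fun i j => ~~ nth false a i && ~~ nth false b j).

Definition perm_rel (s : seq nat) : rel nat := fun i j => nth 0 s i == j.
(** Nonzero patterns of $U_{\sigma_1}P_3U_{\sigma_2}$ and $U_{\sigma_1}P_3^TU_{\sigma_2}$, where
    [i0] is the row that $\sigma_1$ sends to the last one and [s] lists the composite permutation.
    Only these two data matter, whence $2\cdot4\cdot24=192$ crosses. *)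
Definition cross_row (i0 : nat) (s : seq nat) : rel nat :=
  fun i j => if i == i0 then j != nth 0 s i0 else perm_rel s i j.
Definition cross_col (i0 : nat) (s : seq nat) : rel nat :=
  fun i j => (i != i0) && (perm_rel s i j || (j == nth 0 s i0)).

Definition pairs4 : seq bitseq := permutations [:: true; true; false; false].
Definition perms4 : seq (seq nat) := permutations (iota 0 4).

Definition box_masks := [seq box_mask a b | a <- pairs4, b <- pairs4].
Definition diagonal_masks := [seq pq_mask (perm_rel s) (perm_rel s) | s <- perms4].
Definition cross_masks :=
  [seq pq_mask (cross_row i s) (cross_col i s) | i <- iota 0 4, s <- perms4] ++
  [seq pq_mask (cross_col i s) (cross_row i s) | i <- iota 0 4, s <- perms4].
Definition gen_masks := cross_masks ++ box_masks ++ diagonal_masks.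

(* Nested conditionals instead of [&&], which a call-by-value reduction evaluates on both sides. *)
Fixpoint subm (a b : bitseq) : bool :=
  if a is x :: a' then
    if x then if head false b then subm a' (behead b) else false
    else subm a' (behead b)
  else true.
Fixpoint meetm (a b : bitseq) : bool :=
  if a is x :: a' then if b is y :: b' then
    if x then if y then true else meetm a' b' else meetm a' b'
  else false else false.

Lemma submP a b : reflect (forall c, nth false a c -> nth false b c) (subm a b).
Proof.
elim: a b => [|x a IHa] b /=; first by apply: ReflectT => c; rewrite nth_nil.
have nb c : nth false (behead b) c = nth false b c.+1 by rewrite nth_behead.
case: x; last first.
  apply: (iffP (IHa _)) => h c; first by case: c => // c /h; rewrite nb.
  by move=> hc; rewrite nb; apply: (h c.+1).
case: ifP => hb; last first.
  by apply: ReflectF => /(_ 0 isT); rewrite nth0 hb.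
apply: (iffP (IHa _)) => h c; last by move=> hc; rewrite nb; apply: (h c.+1).
by case: c => [|c /h]; rewrite ?nth0 ?nb.
Qed.

Lemma meetmP a b : reflect (exists2 c, nth false a c & nth false b c) (meetm a b).
Proof.
elim: a b => [|x a IHa] [|y b] /=; try by apply: ReflectF => -[c]; rewrite ?nth_nil.
have step : ~~ (x && y) -> reflect (exists2 c, nth false (x :: a) c & nth false (y :: b) c) (meetm a b).
  move=> nxy; apply: (iffP (IHa b)) => -[c]; first by exists c.+1.
  by case: c => [/= hx hy|c]; [rewrite hx hy in nxy | exists c].
case: x y step => -[] step; try exact: step.
by apply: ReflectT; exists 0.
Qed.

(** * Linear identities on [S2] *)

(* [(A, B)] stands for [\sum_(c in A) x_c = \sum_(c in B) x_c]. *)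
Definition rule := (bitseq * bitseq)%type.

(** Since $K$ is an involution, exchanging $P$ and $Q$ preserves the relation $KPK=Q$, so each
    identity has a mirror image; each of the two is then read in both directions. *)
Definition both_ways (p q p' q' : rel nat) : seq rule :=
  [:: (pq_mask p q, pq_mask p' q'); (pq_mask p' q', pq_mask p q);
      (pq_mask q p, pq_mask q' p'); (pq_mask q' p', pq_mask q p)].
(* [P(I x J) = Q(I^c x J^c)] for 2-element sets [I], [J]. *)
Definition box_rules (a b : bitseq) : seq rule :=
  both_ways (fun i j => nth false a i && nth false b j) (fun _ _ => false)
    (fun _ _ => false) (fun i j => ~~ nth false a i && ~~ nth false b j).

(* [\sum_(l != j) P_il + Q_ij = P_ij + \sum_(k != i) Q_kj]. *)
Definition hook_rules (i j : nat) : seq rule :=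
  let e : rel nat := fun k l => (k == i) && (l == j) in
  both_ways (fun k l => (k == i) && (l != j)) e e (fun k l => (k != i) && (l == j)).

(* [P_ij + \sum_(v \notin {j, l}) P_kv + Q_kj = P_il + Q_ij + \sum_(u \notin {i, k}) Q_ul]. *)
Definition zigzag_rules (i k j l : nat) : seq rule :=
  if (i == k) || (j == l) then [::] else
  both_ways
    (fun u v => (u == i) && (v == j) || (u == k) && (v != j) && (v != l))
    (fun u v => (u == k) && (v == j))
    (fun u v => (u == i) && (v == l))
    (fun u v => (u == i) && (v == j) || (u != i) && (u != k) && (v == l)).
Definition rules : seq rule :=
  flatten [seq box_rules a b | a <- pairs4, b <- pairs4] ++
  flatten [seq hook_rules i j | i <- iota 0 4, j <- iota 0 4] ++
  flatten [seq zigzag_rules ik.1 ik.2 jl.1 jl.2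
    | ik <- [seq (i, k) | i <- iota 0 4, k <- iota 0 4],
      jl <- [seq (j, l) | j <- iota 0 4, l <- iota 0 4]].

(** * The decision tree *)

(* Certificates refer to a table entry by two small unary numbers. *)
Definition chunk (T : Type) (n : nat) (s : seq T) : seq (seq T) := reshape (nseq n n) s.
(** The sides of the tables fit the sizes: there are $144+64+576=28^2$ rules, and $252\le16^2$
    masks. *)
Definition rule_table : seq (seq rule) := Eval vm_compute in chunk 28 rules.
Definition gen_table : seq (seq bitseq) := Eval vm_compute in chunk 16 gen_masks.

Definition zero_mask : bitseq := nseq 32 false.
Definition left_mask : bitseq := nseq 16 true ++ nseq 16 false.

(* [Split c t0 t1] branches on [x_c = 0] and [x_c > 0]; the leaves say that an identity is violated,
   that a generator is supported in [supp x], or that [P = 0]. *)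
Inductive cert :=
  | Split of nat & cert & cert
  | ByRule of nat & nat
  | Found of nat & nat
  | Null.

(* [Z] and [P] collect the entries assumed to be zero, respectively positive. *)
Fixpoint check (t : cert) (Z P : bitseq) : bool :=
  match t with
  | Split c t0 t1 =>
    if check t0 (set_nth false Z c true) P then check t1 Z (set_nth false P c true) else false
  | ByRule a b =>
    let: (A, B) := nth ([::], [::]) (nth [::] rule_table a) b in
    if subm B Z then meetm A P else false
  | Found a b =>
    let g := nth [::] (nth [::] gen_table a) b in
    if nilp g then false else subm g P
  | Null => subm left_mask Z
  end.

(* Nothing needs to be proved about [search]: its result is validated by [check]. It branches on an
   entry whose value is forced by an identity if there is one, and otherwise on an entry of the
   generator which is closest to being supported in [supp x]. *)
Fixpoint card_diff (a b : bitseq) : nat :=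
  if a is x :: a' then if b is y :: b' then
    if x then if y then card_diff a' b' else (card_diff a' b').+1 else card_diff a' b'
  else 0 else 0.
Fixpoint first_diff (a b : bitseq) : nat :=
  if a is x :: a' then if b is y :: b' then
    if x then if y then (first_diff a' b').+1 else 0 else (first_diff a' b').+1
  else 0 else 0.

Definition indexed (T : Type) (t : seq (seq T)) : seq (nat * nat * T) :=
  flatten [seq [seq (ir.1, jx.1, jx.2) | jx <- zip (iota 0 (size ir.2)) ir.2]
          | ir <- zip (iota 0 (size t)) t].

Inductive step := Leaf of cert | Branch of nat.

Fixpoint scan_rules (rs : seq (nat * nat * rule)) (Z P : bitseq) (k : option step) : option step :=
  if rs is ((a, b), (A, B)) :: rs' then
    if subm B Z then
      if meetm A P then Some (Leaf (ByRule a b))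
      else scan_rules rs' Z P (Some (Branch (first_diff A Z)))
    else if card_diff B Z == 1 then
      if meetm A P then scan_rules rs' Z P (Some (Branch (first_diff B Z))) else scan_rules rs' Z P k
    else scan_rules rs' Z P k
  else k.
Fixpoint scan_gens (gs : seq (nat * nat * bitseq)) (P : bitseq) (n : nat) (k : step) : step :=
  if gs is ((a, b), g) :: gs' then
    let m := card_diff g P in
    if m == 0 then Leaf (Found a b)
    else if m < n then scan_gens gs' P m (Branch (first_diff g P)) else scan_gens gs' P n k
  else k.

Fixpoint search (fuel : nat) (rs : seq (nat * nat * rule)) (gs : seq (nat * nat * bitseq))
    (Z P : bitseq) : cert :=
  if fuel is fuel'.+1 then
    if subm left_mask Z then Null else
    (* A rule with a positive entry in [B], or with all of [A] zero, can no longer be violated below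
       this node; likewise a generator meeting [Z] can no longer be found. *)
    let rs' := [seq r <- rs | if meetm r.2.2 P then false else ~~ subm r.2.1 Z] in
    let gs' := [seq g <- gs | ~~ meetm g.2 Z] in
    match (if scan_rules rs' Z P None is Some k then k else scan_gens gs' P 33 (Leaf Null)) with
    | Leaf t => t
    | Branch c => Split c (search fuel' rs' gs' (set_nth false Z c true) P)
                          (search fuel' rs' gs' Z (set_nth false P c true))
    end
  else Null.

(** Every branching decides a new one of the 32 entries, so 33 units of fuel suffice. *)
Definition certificate : cert :=
  Eval vm_compute in search 33 (indexed rule_table) (indexed gen_table) zero_mask zero_mask.

Lemma certificate_ok : check certificate zero_mask zero_mask.
Proof. by vm_cast_no_check (erefl true). Qed.

Local Open Scope ring_scope.

(** * Evaluation of masks and identities on matrices *)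

(* On [S2], [4 x_c = \sum_(i, j) wt c i j * P_ij], since [2 K] has entries [-1] on the diagonal and
   [1] elsewhere. *)
Definition wt (c i j : nat) : int :=
  if (c < 16)%N then (if c == (4 * i + j)%N then 4 else 0)
  else (if (c %/ 4 %% 4)%N == i then -1 else 1) * (if (c %% 4)%N == j then -1 else 1).

(** Unlike the locked [\sum], this fold reduces under [vm_compute]. *)
Definition isum (n : nat) (F : nat -> int) : int :=
  foldr (fun i s => F i + s) 0 (iota 0 n).

Lemma isumE n F : isum n F = \sum_(i < n) F i.
Proof. by rewrite -(big_mkord xpredT F) /isum unlock /reducebig /index_iota subn0. Qed.

(** Once everything is written in terms of $P$, an identity holds as soon as its two sides have the
    same 16 coefficients. *)
Definition rule_ok (r : rule) : bool :=
  [&& size r.1 == 32%N, size r.2 == 32%N &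
   all (fun i => all (fun j =>
     isum 32 (fun c => if nth false r.1 c then wt c i j else 0) ==
     isum 32 (fun c => if nth false r.2 c then wt c i j else 0)) (iota 0 4)) (iota 0 4)].

Lemma rules_ok : all rule_ok rules.
Proof. by vm_compute. Qed.

(** The equation $4KPK=4Q$, entry by entry, in integer arithmetic. *)
Definition gen_ok (g : bitseq) : bool :=
  (size g == 32%N) && all (fun k => all (fun l =>
   isum 4 (fun i => isum 4 (fun j =>
     if nth false g (4 * i + j) then wt (16 + (4 * k + l)) i j else 0)) ==
   if nth false g (16 + (4 * k + l)) then 4 else 0) (iota 0 4)) (iota 0 4).

Lemma gen_masks_ok : all gen_ok gen_masks.
Proof. by vm_compute. Qed.

Lemma gen_masks_antichain :
  all (fun g => all (fun h => subm g h ==> (g == h)) gen_masks) gen_masks.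
Proof. by vm_compute. Qed.

Definition ent (R : realFieldType) (x : mpair R) (c : nat) : R :=
  (if (c < 16)%N then x.1 else x.2) (inord (c %/ 4 %% 4)) (inord (c %% 4)).

Definition gmat (R : realFieldType) (g : bitseq) : mpair R :=
  (\matrix_(i, j) (nth false g (4 * i + j))%:R,
   \matrix_(i, j) (nth false g (16 + (4 * i + j)))%:R).

Lemma ent_lo (R : realFieldType) (x : mpair R) (i j : 'I_4) : ent x (4 * i + j) = x.1 i j.
Proof.
have [hi hj] := (ltn_ord i, ltn_ord j); rewrite /ent ifT; last by lia.
by congr (x.1 _ _); apply/val_inj; rewrite /= inordK ?ltn_pmod //; lia.
Qed.

Lemma ent_hi (R : realFieldType) (x : mpair R) (i j : 'I_4) : ent x (16 + (4 * i + j)) = x.2 i j.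
Proof.
have [hi hj] := (ltn_ord i, ltn_ord j); rewrite /ent (_ : (_ < 16)%N = false); last by lia.
by congr (x.2 _ _); apply/val_inj; rewrite /= inordK ?ltn_pmod //; lia.
Qed.

Lemma coordP (c : nat) : (c < 32)%N ->
  exists i j : 'I_4, c = (4 * i + j)%N \/ c = (16 + (4 * i + j))%N.
Proof.
move=> hc; exists (inord (c %/ 4 %% 4)), (inord (c %% 4)).
by rewrite !inordK ?ltn_pmod //; lia.
Qed.

Lemma ent_gmat (R : realFieldType) (g : bitseq) (c : nat) :
  (c < 32)%N -> ent (gmat R g) c = (nth false g c)%:R.
Proof. by case/coordP=> i [j [->|->]]; rewrite ?ent_lo ?ent_hi mxE. Qed.

Lemma ent_inj (R : realFieldType) (x y : mpair R) :
  (forall c, (c < 32)%N -> ent x c = ent y c) -> x = y.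
Proof.
move=> h; apply: injective_projections; apply/matrixP => i j;
  have [hi hj] := (ltn_ord i, ltn_ord j).
  by rewrite -!ent_lo h //; lia.
by rewrite -!ent_hi h //; lia.
Qed.

Lemma conjK_entry (R : realFieldType) (A : 'M[R]_4) (k l : 'I_4) :
  4 * (Kmx R *m A *m Kmx R) k l =
  \sum_(i < 4) \sum_(j < 4) (wt (16 + (4 * k + l)) i j)%:~R * A i j.
Proof.
rewrite mxE mulr_sumr exchange_big /=; apply: eq_bigr => j _.
rewrite mxE mulr_suml mulr_sumr; apply: eq_bigr => i _.
have [hk hl] := (ltn_ord k, ltn_ord l).
have e1 : ((16 + (4 * k + l)) %/ 4 %% 4)%N = k by lia.
have e2 : ((16 + (4 * k + l)) %% 4)%N = l by lia.
rewrite /wt (_ : (_ < 16)%N = false); last by lia.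
rewrite e1 e2 !val_eqE /Kmx !mxE (eq_sym j) rmorphM /=.
by case: eqP => _; case: eqP => _; rewrite ?rmorphN1 ?rmorph1; field.
Qed.

Lemma ent_expand (R : realFieldType) (x : mpair R) (c : nat) : S2 x -> (c < 32)%N ->
  4 * ent x c = \sum_(i < 4) \sum_(j < 4) (wt c i j)%:~R * x.1 i j.
Proof.
move=> [_ [_ hK]] /coordP[k [l [->|->]]]; last by rewrite ent_hi -hK conjK_entry.
have [hk hl] := (ltn_ord k, ltn_ord l).
rewrite ent_lo (bigD1 k) //= (bigD1 l) //= !big1 ?addr0.
- by rewrite /wt ifT ?eqxx //; lia.
- move=> i /eqP ik; rewrite big1 // => j _; rewrite /wt ifT; last by lia.
  rewrite ifF ?mul0r //; have := ltn_ord j; have : val i != val k by apply/eqP=> /val_inj.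
  by move=> /=; lia.
- move=> j /eqP jl; rewrite /wt ifT; last by lia.
  rewrite ifF ?mul0r //; have : val j != val l by apply/eqP=> /val_inj.
  by move=> /=; lia.
Qed.

Lemma ent_ge0 (R : realFieldType) (x : mpair R) (c : nat) : S2 x -> 0 <= ent x c.
Proof. by case=> [hP [hQ _]]; rewrite /ent; case: ifP. Qed.

Definition mass (R : realFieldType) (x : mpair R) (m : bitseq) : R :=
  \sum_(c < 32 | nth false m c) ent x c.

Lemma mass_expand (R : realFieldType) (x : mpair R) (m : bitseq) : S2 x ->
  4 * mass x m = \sum_(i < 4) \sum_(j < 4)
    (isum 32 (fun c => if nth false m c then wt c i j else 0))%:~R * x.1 i j.
Proof.
move=> hx; rewrite /mass mulr_sumr.
under eq_bigr => c _ do rewrite (ent_expand hx (ltn_ord c)).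
rewrite exchange_big; apply: eq_bigr => i _ /=.
rewrite exchange_big; apply: eq_bigr => j _ /=.
by rewrite isumE -big_mkcond rmorph_sum mulr_suml.
Qed.

Lemma rule_mass (R : realFieldType) (x : mpair R) (r : rule) :
  S2 x -> r \in rules -> mass x r.1 = mass x r.2.
Proof.
move=> hx /(allP rules_ok) /and3P[_ _ /allP hr].
apply: (@mulfI _ 4); first by rewrite pnatr_eq0.
rewrite !mass_expand //; apply: eq_bigr => i _; apply: eq_bigr => j _.
have hi : val i \in iota 0 4 by rewrite mem_iota ltn_ord.
have hj : val j \in iota 0 4 by rewrite mem_iota ltn_ord.
by have /allP/(_ _ hj)/eqP -> := hr _ hi.
Qed.

Lemma gmat_S2 (R : realFieldType) (g : bitseq) : g \in gen_masks -> S2 (gmat R g).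
Proof.
move=> /(allP gen_masks_ok) /andP[_ /allP hg].
split; [|split]; try by move=> i j; rewrite mxE ler0n.
apply/matrixP => k l; apply: (@mulfI _ 4); first by rewrite pnatr_eq0.
rewrite conjK_entry mxE.
have hk : val k \in iota 0 4 by rewrite mem_iota ltn_ord.
have hl : val l \in iota 0 4 by rewrite mem_iota ltn_ord.
have /allP/(_ _ hl)/eqP := hg _ hk.
rewrite isumE; under eq_bigr => i _ do rewrite isumE.
move=> /(congr1 (fun z : int => z%:~R : R)); rewrite rmorph_sum /=.
under eq_bigr => i _ do rewrite rmorph_sum /=.
have -> : ((if nth false g (16 + (4 * k + l)) then 4 else 0 : int)%:~R : R)
   = 4 * (nth false g (16 + (4 * k + l)))%:R by case: nth; rewrite ?mulr1 ?mulr0.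
move=> <-; apply: eq_bigr => i _; apply: eq_bigr => j _; rewrite mxE.
by case: nth; rewrite ?mulr1 ?mulr0.
Qed.

(** * Supports of points of [S2] *)

(** Indices in a certificate are arbitrary, so the default [x0] has to be allowed as a value. *)
Lemma mem_chunk (T : eqType) (n : nat) (s : seq T) (x0 : T) (a b : nat) :
  nth x0 (nth [::] (chunk n s) a) b \in x0 :: s.
Proof.
rewrite inE; have [hb|/(nth_default x0) ->] := ltnP b (size (nth [::] (chunk n s) a)); last by rewrite eqxx.
have [ha|/(nth_default [::]) ha] := ltnP a (size (chunk n s)); last by rewrite ha in hb.
apply/orP; right; have : nth x0 (nth [::] (chunk n s) a) b \in flatten (chunk n s).
  by apply/flattenP; exists (nth [::] (chunk n s) a); rewrite mem_nth.
move: (nth x0 _ b) => y; rewrite /chunk; elim: (nseq n n) s {ha hb} => [|k r IHr] s //=.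
by rewrite mem_cat => /orP[/mem_take|/IHr/mem_drop].
Qed.

(** Justifies the leaf [Null]: $P=0$ would force $Q=KPK=0$. *)
Lemma S2_left_neq0 (R : realFieldType) (x : mpair R) : S2 x -> x <> (0, 0) ->
  exists2 c, nth false left_mask c & ent x c != 0.
Proof.
move=> [_ [_ hK]] nx.
have [/existsP[i /existsP[j hij]]|h] := boolP [exists i, exists j, x.1 i j != 0].
  exists (4 * i + j)%N; last by rewrite ent_lo.
  have [hi hj] := (ltn_ord i, ltn_ord j).
  by rewrite nth_cat size_nseq ifT ?nth_nseq ?ifT //; lia.
case: nx; have x1 : x.1 = 0.
  apply/matrixP => i j; rewrite mxE; apply/eqP; apply: contraR h => hij.
  by apply/existsP; exists i; apply/existsP; exists j.
by apply: injective_projections; rewrite // -hK x1 mulmx0 mul0mx.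
Qed.

Lemma check_sound (R : realFieldType) (x : mpair R) (t : cert) (Z P : bitseq) :
  S2 x -> x <> (0, 0) -> check t Z P ->
  (forall c, nth false Z c -> ent x c = 0) -> (forall c, nth false P c -> 0 < ent x c) ->
  exists2 g, g \in gen_masks & forall c, nth false g c -> 0 < ent x c.
Proof.
move=> hx nx; elim: t Z P => [c t0 IH0 t1 IH1|a b|a b|] Z P.
- rewrite /=; case: ifP => // h0 h1 hZ hP.
  have [xc|xc] := eqVneq (ent x c) 0.
    apply: IH0 h0 _ hP => d; rewrite nth_set_nth /=.
    by case: eqP => [-> _|_ /hZ].
  apply: IH1 h1 hZ _ => d; rewrite nth_set_nth /=.
  by case: eqP => [-> _|_ /hP //]; rewrite lt0r xc ent_ge0.
- rewrite /=; have := mem_chunk 28 rules ([::], [::]) a b.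
  rewrite -/rule_table; move: (nth _ _ _) => r hr.
  case: r hr => A B hr; case: ifP => // /submP hB /meetmP[c hA hc] hZ hP.
  (* An index out of range yields the empty rule, whose left side cannot contain [c]. *)
  have {hr} : (A, B) \in rules by move: hr; rewrite inE => /orP[/eqP[eA _]|//]; rewrite eA nth_nil in hA.
  move=> hr; have /and3P[/eqP sA _ _] := allP rules_ok _ hr.
  have c32 : (c < 32)%N by rewrite -sA /=; apply: contraTT hA; rewrite -leqNgt => /(nth_default false) ->.
  (* The side [B] sums to zero, so every term of the nonnegative sum over [A] vanishes, contrary to
     the positivity of entry [c]. *)
  have := rule_mass hx hr; rewrite /mass /= [RHS]big1 => [|d /hB/hZ //].
  move/eqP; rewrite psumr_eq0 => [|d _]; last exact: ent_ge0.
  by move=> /allP/(_ (Ordinal c32) (mem_index_enum _)) /=; rewrite hA /= => /eqP h0; have := hP c hc; rewrite h0 ltxx.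
- rewrite /=; have := mem_chunk 16 gen_masks [::] a b.
  rewrite -/gen_table; move: (nth _ _ _) => g hg.
  case: ifP => // /negP ng /submP hgP hZ hP; exists g; last by move=> c /hgP/hP.
  (* The [nilp] test in [check] rules out the default mask. *)
  by move: hg; rewrite inE => /orP[/eqP eg|//]; rewrite eg in ng.
- move=> /submP h hZ _; have [c /h/hZ ->] := S2_left_neq0 hx nx.
  by rewrite eqxx.
Qed.

Lemma gen_below (R : realFieldType) (x : mpair R) : S2 x -> x <> (0, 0) ->
  exists2 g, g \in gen_masks & forall c, nth false g c -> 0 < ent x c.
Proof.
move=> hx nx; apply: check_sound hx nx certificate_ok _ _ => c;
  by rewrite nth_nseq if_same.
Qed.

(** * The three families as 0/1 masks *)

Lemma gmat_mask (R : realFieldType) (p q : rel nat) :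
  gmat R (pq_mask p q) = (\matrix_(i, j) (p i j)%:R, \matrix_(i, j) (q i j)%:R).
Proof.
apply: injective_projections; apply/matrixP => i j; rewrite !mxE nth_mkseq;
  have [hi hj] := (ltn_ord i, ltn_ord j); try by lia.
  by rewrite ifT; [congr (p _ _)%:R; lia | lia].
by rewrite (_ : (_ < 16)%N = false); [congr (q _ _)%:R; lia | lia].
Qed.

Definition set_bits (A : {set 'I_4}) : bitseq := [seq i \in A | i <- enum 'I_4].

Lemma nth_set_bits (A : {set 'I_4}) (i : 'I_4) : nth false (set_bits A) i = (i \in A).
Proof. by rewrite (nth_map i) ?size_enum_ord // nth_ord_enum. Qed.

Lemma set_bits_onto (a : bitseq) : size a = 4%N -> exists A, a = set_bits A.
Proof.
move=> sa; exists [set i : 'I_4 | nth false a i].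
apply: (@eq_from_nth _ false); first by rewrite size_map size_enum_ord.
by rewrite sa => i hi; rewrite (nth_set_bits _ (Ordinal hi)) inE.
Qed.

Lemma mem_pairs4 (a : bitseq) : (a \in pairs4) = (size a == 4%N) && (count id a == 2%N).
Proof.
rewrite mem_permutations; have [sa|na] := eqVneq (size a) 4%N; last first.
  by apply/negP => /perm_size sa; rewrite sa in na.
case: a sa => [|b0 [|b1 [|b2 [|b3 [|]]]]] //= _.
by case: b0; case: b1; case: b2; case: b3.
Qed.

Lemma set_bits_pairs (A : {set 'I_4}) : (set_bits A \in pairs4) = (A \in two_subsets).
Proof.
rewrite mem_pairs4 size_map size_enum_ord /= count_map mem_filter mem_enum inE andbT.
by rewrite cardE enumT -size_filter; congr (size _ == _); apply: eq_filter.
Qed.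

Lemma boxes_masks (R : realFieldType) : boxes R =i map (gmat R) box_masks.
Proof.
have key (A B : {set 'I_4}) : gmat R (box_mask (set_bits A) (set_bits B)) =
    (indmx R A B, indmx R (~: A) (~: B)).
  rewrite gmat_mask; congr pair; apply/matrixP => i j; rewrite !mxE !nth_set_bits //.
  by rewrite !inE.
move=> g; apply/allpairsP/mapP.
  move=> [[A B] /= [hA hB ->]]; exists (box_mask (set_bits A) (set_bits B)); last by rewrite key.
  by apply: allpairs_f; rewrite set_bits_pairs.
move=> [m /allpairsP[[a b] /= [ha hb ->]] ->].
have /andP[/eqP sa _] := etrans (esym (mem_pairs4 a)) ha.
have /andP[/eqP sb _] := etrans (esym (mem_pairs4 b)) hb.
have [[A eA] [B eB]] := (set_bits_onto sa, set_bits_onto sb).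
by exists (A, B); rewrite /= -!set_bits_pairs -eA -eB ha hb eA eB key.
Qed.

Definition perm_list (s : 'S_4) : seq nat := [seq val (s i) | i <- enum 'I_4].

Lemma nth_perm_list (s : 'S_4) (i : 'I_4) : nth 0%N (perm_list s) i = s i.
Proof. by rewrite (nth_map i) ?size_enum_ord // nth_ord_enum. Qed.

Lemma perm_list_perms (s : 'S_4) : perm_list s \in perms4.
Proof.
rewrite mem_permutations -val_enum_ord /perm_list (map_comp val s).
apply: perm_map; apply: uniq_perm; rewrite ?(map_inj_uniq (@perm_inj _ s)) ?enum_uniq //.
by move=> i; rewrite mem_enum; apply/mapP; exists ((s^-1)%g i); rewrite ?mem_enum ?permKV.
Qed.

Lemma perm_list_onto (l : seq nat) : l \in perms4 -> exists s, l = perm_list s.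
Proof.
rewrite mem_permutations => hl.
have sl : size l = 4%N by rewrite (perm_size hl).
have ll i : (i < 4)%N -> (nth 0 l i < 4)%N.
  by move=> hi; have := mem_nth 0%N (etrans (congr1 (leq i.+1) sl) hi); rewrite (perm_mem hl) mem_iota.
have f_inj : injective (fun i : 'I_4 => inord (nth 0%N l i) : 'I_4).
  move=> i j /(congr1 val); rewrite /= !inordK ?ll // => /eqP.
  by rewrite nth_uniq ?sl // ?(perm_uniq hl) ?iota_uniq // => /eqP/val_inj.
exists (perm f_inj); apply: (@eq_from_nth _ 0%N); first by rewrite size_map size_enum_ord.
by rewrite sl => i hi; rewrite (nth_perm_list _ (Ordinal hi)) permE /= inordK ?ll.
Qed.

Lemma perm_relE (s : 'S_4) (i j : 'I_4) : perm_rel (perm_list s) i j = (s i == j).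
Proof. by rewrite /perm_rel nth_perm_list val_eqE. Qed.

Lemma diagonals_masks (R : realFieldType) : diagonals R =i map (gmat R) diagonal_masks.
Proof.
have key (s : 'S_4) : gmat R (pq_mask (perm_rel (perm_list s)) (perm_rel (perm_list s))) =
    (perm_mx s, perm_mx s).
  by rewrite gmat_mask; congr pair; apply/matrixP => i j; rewrite !mxE perm_relE.
move=> g; apply/mapP/mapP => [[s _ ->]|[m /mapP[l /perm_list_onto[s ->] ->] ->]].
  by rewrite -key; eexists; first exact: map_f (perm_list_perms s).
exists s; [by rewrite mem_enum inE | exact: key].
Qed.

Lemma cross_matrix (R : realFieldType) (s1 s2 : 'S_4) (i0 : 'I_4) : s1 i0 = ord_max ->
  let l := perm_list (s1 * s2) in
  perm_mx s1 *m P3 R *m perm_mx s2 = \matrix_(i, j) (cross_row i0 l i j)%:R /\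
  perm_mx s1 *m (P3 R)^T *m perm_mx s2 = \matrix_(i, j) (cross_col i0 l i j)%:R.
Proof.
move=> s1i0 l.
have e3 i : (val (s1 i) == 3%N) = (i == i0).
  by rewrite -(inj_eq (@perm_inj _ s1)) s1i0.
have f3 j : (val ((s2^-1)%g j) == 3%N) = (j == (s1 * s2)%g i0).
  by rewrite permM s1i0 -[in RHS](inj_eq (@perm_inj _ (s2^-1)%g)) permK -val_eqE.
have ij i j : (s1 i == (s2^-1)%g j) = ((s1 * s2)%g i == j).
  by rewrite permM -(inj_eq (@perm_inj _ s2) (s1 i)) permKV.
split; apply/matrixP => i j; rewrite -row_permE -[s2]invgK -col_permE !mxE.
  rewrite e3 f3 ij /cross_row perm_relE /l nth_perm_list !val_eqE.
  by case: ifP.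
rewrite e3 f3 [(s2^-1)%g j == _]eq_sym ij /cross_col perm_relE /l nth_perm_list !val_eqE (eq_sym j).
case: (eqVneq i i0) => [->|ni] /=; first by case: eqP.
by case: eqVneq; rewrite ?orbT ?orbF.
Qed.

Lemma cross_orbit (R : realFieldType) (F : 'S_4 -> 'S_4 -> mpair R) (m : nat -> seq nat -> bitseq) :
  (forall (s1 s2 : 'S_4) (i0 : 'I_4), s1 i0 = ord_max -> F s1 s2 = gmat R (m i0 (perm_list (s1 * s2)))) ->
  [seq F s1 s2 | s1 <- enum [set: 'S_4], s2 <- enum [set: 'S_4]] =i
  map (gmat R) [seq m i s | i <- iota 0 4, s <- perms4].
Proof.
move=> hF g; apply/allpairsP/mapP => [[[s1 s2] [_ _ ->]]|[_ /allpairsP[[i l] [hi hl ->]] ->]].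
  rewrite (hF s1 s2 _ (permKV s1 ord_max)); set i0 := (s1^-1)%g _.
  exists (m i0 (perm_list (s1 * s2))) => //.
  by apply: allpairs_f; [rewrite mem_iota ltn_ord | exact: perm_list_perms].
have {}hi : (i < 4)%N by rewrite mem_iota in hi.
have [s ->] := perm_list_onto hl.
(* The first factor moves row [i] to the last one; the second is chosen to make the product [s]. *)
exists (tperm (Ordinal hi) ord_max, (tperm (Ordinal hi) ord_max)^-1 * s)%g.
by rewrite !mem_enum !inE (hF _ _ (Ordinal hi)) ?tpermL //= mulKVg.
Qed.

Lemma crosses_masks (R : realFieldType) : crosses R =i map (gmat R) cross_masks.
Proof.
move=> g; rewrite map_cat !mem_cat; congr (_ || _); apply: cross_orbit => s1 s2 i0 e;
  by have [-> ->] := cross_matrix R s2 e; rewrite gmat_mask.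
Qed.

(** * Conic decompositions and extremal rays *)

Lemma gen_masks_size (g : bitseq) : g \in gen_masks -> size g = 32%N.
Proof. by move=> /(allP gen_masks_ok)/andP[/eqP]. Qed.

Lemma gmat_inj (R : realFieldType) : {in gen_masks &, injective (gmat R)}.
Proof.
move=> g h hg hh e; apply: (@eq_from_nth _ false); first by rewrite !gen_masks_size.
move=> c; rewrite gen_masks_size // => hc; have := ent_gmat R g hc.
by rewrite e ent_gmat // => /eqP; rewrite eqr_nat; case: nth; case: nth.
Qed.

Lemma gen_masks_eq (g h : bitseq) : g \in gen_masks -> h \in gen_masks ->
  (forall c, nth false g c -> nth false h c) -> g = h.
Proof.
move=> hg hh /submP gh; apply/eqP.
by have /allP/(_ h hh) := allP gen_masks_antichain g hg; rewrite gh.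
Qed.

Lemma gen_masks_neq0 (g : bitseq) : g \in gen_masks -> exists2 c, (c < 32)%N & nth false g c.
Proof.
have h : all (has id) gen_masks by vm_compute.
move=> hg; have /allP/(_ g hg)/(has_nthP false)[c hc gc] := h.
by exists c; rewrite // -(gen_masks_size hg).
Qed.

Lemma nth_mask_lt (g : bitseq) (c : nat) : g \in gen_masks -> nth false g c -> (c < 32)%N.
Proof.
move=> hg; rewrite -(gen_masks_size hg) ltnNge; apply: contraTN => hc.
by rewrite nth_default.
Qed.

Lemma entD (R : realFieldType) (x y : mpair R) c : ent (padd x y) c = ent x c + ent y c.
Proof. by rewrite /ent; case: ifP; rewrite /= mxE. Qed.

Lemma entZ (R : realFieldType) (t : R) (x : mpair R) c : ent (pscale t x) c = t * ent x c.
Proof. by rewrite /ent; case: ifP; rewrite /= mxE. Qed.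

Lemma ent_0 (R : realFieldType) c : ent ((0, 0) : mpair R) c = 0.
Proof. by rewrite /ent; case: ifP; rewrite /= mxE. Qed.

Lemma S2_sub (R : realFieldType) (x y : mpair R) (t : R) : S2 x -> S2 y ->
  (forall c, (c < 32)%N -> t * ent y c <= ent x c) -> S2 (padd x (pscale (- t) y)).
Proof.
move=> [_ [_ hx]] [_ [_ hy]] h.
have h' c : (c < 32)%N -> 0 <= ent (padd x (pscale (- t) y)) c.
  by move=> hc; rewrite entD entZ mulNr subr_ge0 h.
split; [|split]; try by move=> i j; have [hi hj] := (ltn_ord i, ltn_ord j);
  rewrite -?ent_lo -?ent_hi; apply: h'; lia.
by rewrite /= mulmxDr mulmxDl hx -scalemxAr -scalemxAl hy.
Qed.

Definition support (R : realFieldType) (x : mpair R) : {set 'I_32} := [set c : 'I_32 | 0 < ent x c].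

Lemma peel (R : realFieldType) (x : mpair R) (g : bitseq) : S2 x -> g \in gen_masks ->
  (forall c, nth false g c -> 0 < ent x c) ->
  exists t y, [/\ 0 < t, S2 y, x = padd (pscale t (gmat R g)) y & support y \proper support x].
Proof.
move=> hx hg gx; have [c0 c0lt gc0] := gen_masks_neq0 hg.
(* The multiple [t] is the least entry of [x] on the support of [g]: subtracting [t] times the
   generator keeps all entries nonnegative and kills entry [c]. *)
have [c gc cmin] := @arg_minP _ _ _ (Ordinal c0lt) (fun c => nth false g c) (fun c => ent x c) gc0.
set t := ent x c in cmin; exists t, (padd x (pscale (- t) (gmat R g))).
have hy : S2 (padd x (pscale (- t) (gmat R g))).
  apply: S2_sub => // [|d hd]; first exact: gmat_S2.
  rewrite ent_gmat //; case gd: (nth false g d); last by rewrite mulr0 ent_ge0.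
  by rewrite mulr1; apply: (cmin (Ordinal hd)).
have ey d : (d < 32)%N -> ent (padd x (pscale (- t) (gmat R g))) d = ent x d - t * (nth false g d)%:R.
  by move=> hd; rewrite entD entZ mulNr ent_gmat.
split=> //; first exact: gx.
  by apply: ent_inj => d hd; rewrite entD ey // entZ ent_gmat // addrC subrK.
apply/properP; split.
  apply/subsetP => d; rewrite !inE ey // => h; apply: lt_le_trans h _.
  by rewrite gerBl mulr_ge0 // ltW // gx.
by exists c; rewrite !inE ?gx // ey // gc mulr1 subrr ltxx.
Qed.

Definition conic (R : realFieldType) (x : mpair R) (f : bitseq -> R) : Prop :=
  forall c, (c < 32)%N -> ent x c = \sum_(g <- gen_masks) f g * (nth false g c)%:R.

Lemma gen_masks_uniq : uniq gen_masks.
Proof. by vm_compute. Qed.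

Lemma conic_decomposition (R : realFieldType) (x : mpair R) : S2 x ->
  exists2 f : bitseq -> R, (forall g, 0 <= f g) & conic x f.
Proof.
have [n] := ubnP #|support x|; elim: n x => // n IHn x le_n hx.
have [->|/eqP nx] := eqVneq x (0, 0).
  by exists (fun=> 0) => // c _; rewrite ent_0 big1 // => g _; rewrite mul0r.
have [g hg gx] := gen_below hx nx.
have [t [y [t0 hy exy sub]]] := peel hx hg gx.
have [f f0 hf] := IHn y (leq_trans (proper_card sub) le_n) hy.
exists (fun h => f h + (if h == g then t else 0)).
  by move=> h; rewrite addr_ge0 //; case: ifP => // _; apply: ltW.
move=> c hc; rewrite exy entD entZ ent_gmat // hf // addrC.
under [RHS]eq_bigr => h _ do rewrite mulrDl.
rewrite big_split /=; congr (_ + _).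
rewrite (bigD1_seq g) ?gen_masks_uniq //= eqxx big1 ?addr0 // => h /negPf ->.
by rewrite mul0r.
Qed.

(** Nonnegative terms cannot cancel, so a generator used with positive weight has its support inside
    that of [x]. *)
Lemma conic_gt0 (R : realFieldType) (x : mpair R) (f : bitseq -> R) (g : bitseq) c :
  (forall g, 0 <= f g) -> conic x f -> g \in gen_masks -> 0 < f g -> nth false g c -> 0 < ent x c.
Proof.
move=> f0 hf hg fg gc; rewrite hf; last exact: nth_mask_lt hg gc.
rewrite (bigD1_seq g) ?gen_masks_uniq //= gc mulr1 ltr_wpDr // sumr_ge0 // => h _.
by rewrite mulr_ge0.
Qed.

Lemma conic_single (R : realFieldType) (x : mpair R) (f : bitseq -> R) (g : bitseq) :
  conic x f -> g \in gen_masks -> (forall h, h \in gen_masks -> h != g -> f h = 0) ->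
  x = pscale (f g) (gmat R g).
Proof.
move=> hf hg f0; apply: ent_inj => c hc; rewrite hf // entZ ent_gmat //.
rewrite (bigD1_seq g) ?gen_masks_uniq //= big_seq_cond big1 ?addr0 // => h /andP[hh hn].
by rewrite f0 // mul0r.
Qed.

Lemma gmat_extremal (R : realFieldType) (g : bitseq) :
  g \in gen_masks -> extremal (@S2 R) (gmat R g).
Proof.
move=> hg; split; first exact: gmat_S2.
split=> [e|y z hy hz e].
  have [c hc gc] := gen_masks_neq0 hg; have := ent_gmat R g hc.
  by rewrite e ent_0 gc => /esym/eqP; rewrite oner_eq0.
have [f f0 hf] := conic_decomposition hy; exists (f g); split=> //.
apply: conic_single => // h hh hn; apply/eqP; rewrite eq_le f0 andbT leNgt.
apply: contra hn => fh; apply/eqP; apply: gen_masks_eq => // c hc.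
have c32 := nth_mask_lt hh hc; have := conic_gt0 f0 hf hh fh hc.
have := congr1 (fun x => ent x c) e; rewrite entD ent_gmat //.
(* If entry [c] of the generator were 0, then [y] and [z] would have opposite entries there,
   although that of [y] is positive. *)
case: nth => // ez; rewrite ltNge => /negP[]; rewrite -[_ <= 0](lerD2r (ent z c)) -ez add0r; exact: ent_ge0.
Qed.

Lemma extremal_gmat (R : realFieldType) (x : mpair R) : extremal (@S2 R) x ->
  exists2 g, g \in gen_masks & exists t : R, 0 < t /\ x = pscale t (gmat R g).
Proof.
move=> [hx [nx ex]]; have [g hg gx] := gen_below hx nx.
have [t [y [t0 hy exy _]]] := peel hx hg gx.
have hS : S2 (pscale t (gmat R g)).
  have [hP [hQ hK]] := gmat_S2 R hg; split; [|split].
  - by move=> i j; rewrite mxE mulr_ge0 // ltW.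
  - by move=> i j; rewrite mxE mulr_ge0 // ltW.
  - by rewrite /= -scalemxAr -scalemxAl hK.
have [u [u0 eu]] := ex _ _ hS hy exy; exists g => //.
have [c hc gc] := gen_masks_neq0 hg.
(* Comparison at an entry where the generator equals 1 shows that [u] is nonzero, so the relation
   can be inverted. *)
have etu : t = u * ent x c by have := congr1 (fun x => ent x c) eu; rewrite !entZ ent_gmat // gc mulr1.
have u_gt0 : 0 < u by rewrite lt0r u0 andbT; apply: contraTneq t0 => u_0; rewrite etu u_0 mul0r ltxx.
exists (u^-1 * t); split; first by rewrite mulr_gt0 ?invr_gt0.
apply: ent_inj => d hd; have := congr1 (fun x => ent x d) eu; rewrite !entZ -mulrA => ->.
by rewrite mulrA mulVf ?mul1r ?gt_eqF.
Qed.

(** * Distinctness and number of the rays *)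

Lemma pscale_gmat_inj (R : realFieldType) (g h : bitseq) (t : R) :
  g \in gen_masks -> h \in gen_masks -> gmat R g = pscale t (gmat R h) -> g = h.
Proof.
move=> hg hh e; apply: gen_masks_eq => // c gc; have c32 := nth_mask_lt hg gc.
have := ent_gmat R g c32; rewrite e entZ ent_gmat // gc.
by case: nth => // /eqP; rewrite mulr0 eq_sym oner_eq0.
Qed.

(** Turns counting matrix pairs over [R] into counting concrete masks, which is a computation. *)
Lemma size_undup_gmat (R : realFieldType) (s : seq (mpair R)) (m : seq bitseq) :
  s =i map (gmat R) m -> uniq m -> {subset m <= gen_masks} -> size (undup s) = size m.
Proof.
move=> /perm_undup/perm_size -> um sub; rewrite undup_id ?size_map //.
by rewrite map_inj_in_uniq // => g h /sub hg /sub hh; apply: gmat_inj.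
Qed.

Lemma mem_gen_masks (g : bitseq) :
  (g \in gen_masks) = [|| g \in box_masks, g \in diagonal_masks | g \in cross_masks].
Proof.
rewrite /gen_masks; move: cross_masks box_masks diagonal_masks => c b d.
by rewrite !mem_cat orbC orbA.
Qed.

Lemma families_masks (R : realFieldType) :
  boxes R ++ diagonals R ++ crosses R =i map (gmat R) gen_masks.
Proof.
move=> g; rewrite mem_cat mem_cat boxes_masks diagonals_masks crosses_masks /gen_masks.
(* Abstracting the lists keeps [mem_cat] from splitting [cross_masks], itself a concatenation. *)
move: cross_masks box_masks diagonal_masks => c b d.
by rewrite !map_cat !mem_cat orbA orbC.
Qed.

Theorem mainTheorem10 (R : realFieldType) :
  (* family sizes (distinct members) *)
  size (undup (boxes R)) = 36%N /\
  size (undup (diagonals R)) = 24%N /\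
  size (undup (crosses R)) = 192%N /\
  (* every member of each family generates an extremal ray *)
  (forall g, g \in boxes R ++ diagonals R ++ crosses R -> extremal (@S2 R) g) /\
  (* distinct generators span distinct rays, and there are 252 of them *)
  size (generators R) = 252%N /\
  (forall g h, g \in generators R -> h \in generators R ->
     (exists t : R, 0 < t /\ g = pscale t h) -> g = h) /\
  (* every extremal ray is one of these: exactly 252 extremal rays *)
  (forall x, extremal (@S2 R) x ->
     exists2 g, g \in generators R & exists t : R, 0 < t /\ x = pscale t g) /\
  (* S_2 is the conic hull of the three families *)
  (forall x : mpair R, S2 x <->
     exists c : 'I_(size (generators R)) -> R,
       (forall i, 0 <= c i) /\
       x.1 = \sum_(i < size (generators R)) c i *: (nth (0, 0) (generators R) i).1 /\
       x.2 = \sum_(i < size (generators R)) c i *: (nth (0, 0) (generators R) i).2).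
Proof.
have gens : generators R =i map (gmat R) gen_masks.
  by move=> g; rewrite mem_undup families_masks.
have gens_perm : perm_eq (generators R) (map (gmat R) gen_masks).
  apply: uniq_perm gens; first exact: undup_uniq.
  by rewrite map_inj_in_uniq ?gen_masks_uniq //; exact: gmat_inj.
split; first by rewrite (size_undup_gmat (@boxes_masks R)) // => g hg; rewrite mem_gen_masks hg.
split; first by rewrite (size_undup_gmat (@diagonals_masks R)) // => g hg; rewrite mem_gen_masks hg orbT.
split; first by rewrite (size_undup_gmat (@crosses_masks R)) // => g hg; rewrite mem_gen_masks hg !orbT.
split; first by move=> g; rewrite families_masks => /mapP[m hm ->]; exact: gmat_extremal.
split; first by rewrite (perm_size gens_perm) size_map.
split.
  move=> g h; rewrite !gens => /mapP[a ha ->] /mapP[b hb ->] [t [_ e]].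
  by rewrite (pscale_gmat_inj ha hb e).
split.
  move=> x /extremal_gmat[g hg ht]; exists (gmat R g) => //.
  by rewrite gens map_f.
move=> x; split=> [hx|[c [c0 [e1 e2]]]].
  have [f f0 hf] := conic_decomposition hx.
  (* The weights [f] are indexed by masks, the required ones by generators; [k] recovers the mask of
     a generator from its position. *)
  pose k (y : mpair R) := f (nth [::] gen_masks (index y (map (gmat R) gen_masks))).
  have kf g : g \in gen_masks -> k (gmat R g) = f g.
    move=> hg; rewrite /k; congr f; apply: (@gmat_inj R) => //.
      by rewrite mem_nth // -(size_map (gmat R)) index_mem map_f.
    by rewrite -(nth_map _ (gmat R [::])) ?nth_index ?map_f // -(size_map (gmat R)) index_mem map_f.
  have sumE (i : mpair R -> 'M[R]_4) :
      \sum_(j < size (generators R)) k (nth (0, 0) (generators R) j) *: i (nth (0, 0) (generators R) j) =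
      \sum_(g <- gen_masks) f g *: i (gmat R g).
    rewrite -(big_mkord xpredT (fun j => k (nth (0, 0) (generators R) j) *: i (nth (0, 0) (generators R) j))).
    rewrite -(big_nth (0, 0) xpredT (fun y => k y *: i y)) (perm_big _ gens_perm) big_map /=.
    by rewrite big_seq [RHS]big_seq; apply: eq_bigr => g /kf ->.
  exists (fun j => k (nth (0, 0) (generators R) j)); split; first by move=> j; exact: f0.
  rewrite (sumE fst) (sumE snd); split; apply/matrixP => i j; have [hi hj] := (ltn_ord i, ltn_ord j).
    rewrite summxE -ent_lo hf; last by lia.
    by apply: eq_bigr => g _; rewrite !mxE.
  rewrite summxE -ent_hi hf; last by lia.
  by apply: eq_bigr => g _; rewrite !mxE.
have hS (i : 'I_(size (generators R))) : S2 (nth (0, 0) (generators R) i).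
  have : nth (0, 0) (generators R) i \in generators R by rewrite mem_nth.
  by rewrite gens => /mapP[g hg ->]; exact: gmat_S2.
split; [|split].
- move=> i j; rewrite e1 summxE sumr_ge0 // => k _; rewrite mxE mulr_ge0 //.
  by case: (hS k).
- move=> i j; rewrite e2 summxE sumr_ge0 // => k _; rewrite mxE mulr_ge0 //.
  by case: (hS k) => _ [].
- rewrite e1 e2 mulmx_sumr mulmx_suml; apply: eq_bigr => k _.
  by case: (hS k) => _ [_ <-]; rewrite -scalemxAr -scalemxAl.
Qed.
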